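(* Let $\sigma = (\lambda_1,\lambda_2,\lambda_3,\lambda_4,\lambda_5)$ be a list of real numbers such that (i) $e_1(\sigma)=\lambda_1+\lambda_2+\lambda_3+\lambda_4+\lambda_5\ge 0$; (ii) $\lambda_3 > e_1(\sigma)$; (iii) $\lambda_1\ge\lambda_2\ge\lambda_3\ge\lambda_4\ge\lambda_5\ge-\lambda_1$. Further assume that $g$ is a real root of the polynomial $Q_\sigma(z)$ and $0\le g\le \frac12 e_1(\sigma)$. Then the matrix $B(\sigma,g)$ is (entrywise) nonnegative, and so $\sigma$ is realizable by a $5\times5$ nonnegative symmetric matrix.
   Context: For a list $\sigma=(\lambda_1,\dots,\lambda_5)$ let $e_n = e_n(\sigma)=\sum_{1\le j_1<\dots<j_n\le 5}\prod_{i=1}^n \lambda_{j_i}$ ($n=1,\dots,5$) be the elementary symmetric functions, and let $$Q_\sigma(z)=2z^3-2(\lambda_3+\lambda_5)z^2-\left(e_2+(\lambda_3-\lambda_5)^2\right)z+e_3+e_1(\lambda_3^2+\lambda_5^2).$$ For a number $g$ define $$k=g-\lambda_3-\lambda_5,\qquad l=(g-\lambda_3)(\lambda_5-g),\qquad m=-g^2+e_1 g-\tfrac12\left(e_2+\lambda_3^2+\lambda_5^2\right),$$ $$B(\sigma,g)=\begin{pmatrix} g&\sqrt l&\sqrt m&0&0\\ \sqrt l&0&0&0&k\\ \sqrt m&0&e_1-2g&\sqrt m&0\\ 0&0&\sqrt m&g&\sqrt l\\ 0&k&0&\sqrt l&0\end{pmatrix},$$ where $\sqrt{\cdot}$ is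 the principal square root: for $z=\varrho\, e^{i\varphi}$ with $\varrho\ge 0$, $-\pi<\varphi\le\pi$, $\sqrt z=\sqrt{\varrho}\,e^{i\varphi/2}$. A matrix is nonnegative if all its entries are nonnegative real numbers. A list $\sigma$ is realizable by a matrix if it is the spectrum of that matrix (eigenvalues counted with multiplicity). *)

(* Defs.v *)
From HB Require Import structures.
From mathcomp Require Import all_boot all_order all_algebra.
From mathcomp Require Import complex.
From mathcomp Require Import reals trigo.
Set Implicit Arguments.
Unset Strict Implicit.
Unset Printing Implicit Defensive.
Import Order.TTheory GRing.Theory Num.Theory.
Local Open Scope ring_scope.
Local Open Scope complex_scope.

(* Lists are indexed from 0, so s`_2 is lambda_3 and s`_4 is lambda_5. *)

(* The index set j_1 < ... < j_n is encoded as an n-element set of indices. *)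
Definition elsym (F : comNzRingType) (n : nat) (s : 5.-tuple F) : F :=
  \sum_(J : {set 'I_5} | #|J| == n) \prod_(j in J) s`_j.

Definition Qpoly (F : fieldType) (s : 5.-tuple F) : {poly F} :=
  2%:P * 'X^3 - (2 * (s`_2 + s`_4))%:P * 'X^2
    - (elsym 2 s + (s`_2 - s`_4) ^+ 2)%:P * 'X
    + (elsym 3 s + elsym 1 s * (s`_2 ^+ 2 + s`_4 ^+ 2))%:P.

Definition kB (F : fieldType) (s : 5.-tuple F) (g : F) : F := g - s`_2 - s`_4.

Definition lB (F : fieldType) (s : 5.-tuple F) (g : F) : F :=
  (g - s`_2) * (s`_4 - g).

Definition mB (F : fieldType) (s : 5.-tuple F) (g : F) : F :=
  - g ^+ 2 + elsym 1 s * g - 2^-1 * (elsym 2 s + s`_2 ^+ 2 + s`_4 ^+ 2).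

(* sqrtc is the principal complex square root, see sqrtc_polar below. *)
Definition Bmx (R : rcfType) (s : 5.-tuple R[i]) (g : R[i]) : 'M[R[i]]_5 :=
  let k := kB s g in
  let sl := sqrtc (lB s g) in
  let sm := sqrtc (mB s g) in
  \matrix_(i < 5, j < 5)
    nth 0 (nth [::]
      [:: [:: g;  sl; sm;                 0;  0 ];
          [:: sl; 0;  0;                  0;  k ];
          [:: sm; 0;  elsym 1 s - 2 * g;   sm; 0 ];
          [:: 0;  0;  sm;                 g;  sl];
          [:: 0;  k;  0;                  sl; 0 ]] i) j.

(* Over R[i], 0 <= z means that z is a nonnegative real number. *)
Definition nonneg_mx (F : numDomainType) (m n : nat) (A : 'M[F]_(m, n)) : Prop :=
  forall i j, 0 <= A i j.

(* s is the spectrum of A, eigenvalues being counted with multiplicity. *)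
Definition realized_by (F : comNzRingType) (n : nat) (s : seq F) (A : 'M[F]_n) :
    Prop :=
  char_poly A = \prod_(x <- s) ('X - x%:P).

Lemma sqrtc_polar (R : realType) (rho phi : R) :
  0 <= rho -> - pi < phi -> phi <= pi ->
  sqrtc ((rho * cos phi) +i* (rho * sin phi)) =
  (Num.sqrt rho * cos (phi / 2)) +i* (Num.sqrt rho * sin (phi / 2)).
Proof.
move=> r0 ph1 ph2.
set t := phi / 2.
have ephi : phi = t *+ 2 by rewrite /t -mulr_natr divfK // pnatr_eq0.
have t1 : - (pi / 2) < t by rewrite /t -mulNr ltr_pM2r ?invr_gt0 ?ltr0n.
have t2 : t <= pi / 2 by rewrite /t ler_pM2r ?invr_gt0 ?ltr0n.
have ct0 : 0 <= cos t by apply: cos_ge0_pihalf; rewrite t2 ltW.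
have n2 : (2 : R) != 0 by rewrite pnatr_eq0.
have sE : sin phi = cos t * sin t *+ 2 by rewrite ephi sin_mulr2n.
have cE : cos phi = cos t ^+ 2 *+ 2 - 1 by rewrite ephi cos_mulr2n.
have rE : Num.sqrt ((rho * cos phi) ^+ 2 + (rho * sin phi) ^+ 2) = rho.
  by rewrite !exprMn -mulrDr cos2Dsin2 mulr1 sqrtr_sqr ger0_norm.
have pE : (rho + rho * cos phi) / 2 = rho * cos t ^+ 2.
  rewrite -[X in X + _]mulr1 -mulrDr cE [1 + _]addrC subrK.
  by rewrite -[cos t ^+ 2 *+ 2]mulr_natr mulrA mulfK.
have mE : (rho - rho * cos phi) / 2 = rho * sin t ^+ 2.
  rewrite -[X in X - _]mulr1 -mulrBr cE opprB addrA -mulr2n -mulrnBl.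
  by rewrite -[X in X - _](cos2Dsin2 t) addrAC subrr add0r -[sin t ^+ 2 *+ 2]mulr_natr mulrA mulfK.
rewrite /sqrtc rE pE mE !(sqrtrM _ r0) !sqrtr_sqr (ger0_norm ct0).
congr (_ +i* _); rewrite mulrCA.
have [->|rn0] := eqVneq rho 0; first by rewrite sqrtr0 !mul0r.
have rp : 0 < rho by rewrite lt_neqAle eq_sym rn0.
congr (_ * _).
rewrite mulf_eq0 (negbTE rn0) /= sgrM (gtr0_sg rp) mul1r.
have [s0|s0] := eqVneq (sin phi) 0.
  rewrite mul1r ger0_norm // leNgt; apply/negP => st.
  have tn : t < 0.
    rewrite ltNge; apply/negP => tp.
    suff : 0 <= sin t by rewrite leNgt st.
    apply: sin_ge0_pi; rewrite tp (le_trans t2) //.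
    by rewrite ler_pdivrMr ?ltr0n // ler_peMr ?pi_ge0 // ler1n.
  have : 0 < sin (- phi).
    apply: sin_gt0_pi; rewrite oppr_gt0 ltrNl ph1 andbT.
    by rewrite ephi mulrn_wlt0.
  by rewrite sinN s0 oppr0 ltxx.
have cp : 0 < cos t.
  rewrite lt_neqAle ct0 andbT eq_sym; apply: contra_neq s0 => ct.
  by rewrite sE ct mul0r mul0rn.
have -> : Num.sg (sin phi) = Num.sg (sin t).
  by rewrite sE -mulr_natr !sgrM (gtr0_sg cp) mul1r sgr_nat mulr1.
by rewrite -numEsg.
Qed.

(* Main.v *)
(** The matrix commutes with the reversal of the five coordinates, so it splits
    into a 2x2 block on antisymmetric vectors, whose characteristic polynomial
    is (X - lambda_3)(X - lambda_5) by the choice of k and l, and a 3x3 block on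
    symmetric vectors. The trace and the second coefficient of the 3x3 block
    agree with those of (X - lambda_1)(X - lambda_2)(X - lambda_4) by the choice
    of m, and its determinant agrees exactly when Q(g) = 0.

    For nonnegativity of m, note that
    4 m = 4 g (e_1 - g) + (lambda_1^2 - lambda_5^2) + (lambda_2^2 - lambda_3^2)
          + (lambda_4^2 - e_1^2),
    where lambda_4 < - e_1 because lambda_1 + lambda_5 >= 0 and
    lambda_2 >= lambda_3 > e_1. *)
Require Import Defs.
From mathcomp Require Import all_boot all_order all_algebra.
From mathcomp Require Import complex.
From mathcomp Require Import reals.
From mathcomp Require Import ring lra.
Import Order.TTheory GRing.Theory Num.Theory.
Local Open Scope ring_scope.
Local Open Scope complex_scope.

(** Expanding the product selects the subset [J] of factors that contribute their linear term, hence
    degree [#|J|]. The sum over sets thus becomes a coefficient that plain algebra computes. *)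
Lemma coef_prod_1DcX (F : comNzRingType) (n : nat) (s : 5.-tuple F) :
  (\prod_(i < 5) (s`_i *: 'X + 1))`_n = elsym n s.
Proof.
rewrite bigA_distr coef_sum /elsym [RHS]big_mkcond; apply: eq_bigr => J _.
rewrite -big_mkcond /= scaler_prod prodr_const coefZ coefXn eq_sym.
by case: eqP; rewrite ?mulr1 ?mulr0.
Qed.

Lemma elsym123E (F : comNzRingType) (s : 5.-tuple F) :
  [/\ elsym 1 s = s`_0 + s`_1 + s`_2 + s`_3 + s`_4,
      elsym 2 s = s`_0 * s`_1 + (s`_0 + s`_1) * s`_2
        + (s`_0 + s`_1 + s`_2) * s`_3 + (s`_0 + s`_1 + s`_2 + s`_3) * s`_4
    & elsym 3 s = s`_0 * s`_1 * s`_2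
        + (s`_0 * s`_1 + (s`_0 + s`_1) * s`_2) * s`_3
        + (s`_0 * s`_1 + (s`_0 + s`_1) * s`_2 + (s`_0 + s`_1 + s`_2) * s`_3)
            * s`_4].
Proof.
rewrite -!coef_prod_1DcX !big_ord_recr big_ord0 /= mul1r.
move: s`_0 s`_1 s`_2 s`_3 s`_4 => a b c d e.
have -> : (a *: 'X + 1) * (b *: 'X + 1) * (c *: 'X + 1) * (d *: 'X + 1) * (e *: 'X + 1) =
  1%:P + (a + b + c + d + e)%:P * 'X
  + (a * b + (a + b) * c + (a + b + c) * d + (a + b + c + d) * e)%:P * 'X^2
  + (a * b * c + (a * b + (a + b) * c) * d
     + (a * b + (a + b) * c + (a + b + c) * d) * e)%:P * 'X^3
  + ((a * b * (c + d) + (a + b) * c * d) * e + a * b * c * d)%:P * 'X^4 + (a * b * c * d * e)%:P * 'X^5.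
  by rewrite -!mul_polyC; ring.
by rewrite !coefE /= !(mulr0, mulr1, addr0, add0r).
Qed.

(** Exchanging coordinates 0 with 3 and 1 with 4 preserves the matrix; the two factors are its
    determinants on antisymmetric and on symmetric vectors. The entry [q] is general because the
    corresponding zeros of B become ['X] in the characteristic matrix. *)
Lemma det_flip (F : comNzRingType) (p q w u v k : F) :
  \det (\matrix_(i < 5, j < 5)
    nth 0 (nth [::]
      [:: [:: p; u; v; 0; 0];
          [:: u; q; 0; 0; k];
          [:: v; 0; w; v; 0];
          [:: 0; 0; v; p; u];
          [:: 0; k; 0; u; q]] i) j) =
  (p * (q - k) - u ^+ 2) * (w * (p * (q + k) - u ^+ 2) - 2 * v ^+ 2 * (q + k)).
Proof.
do 4 rewrite ?(expand_det_row _ ord0) !big_ord_recl !big_ord0 /cofactor !mxE /= ?(mul0r, addr0, add0r).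
rewrite !det_mx11 !mxE /=.
ring.
Qed.

Lemma elsym_map (F K : comNzRingType) (f : {rmorphism F -> K}) (n : nat)
    (s : 5.-tuple F) :
  elsym n (map_tuple f s) = f (elsym n s).
Proof.
rewrite /elsym rmorph_sum; apply: eq_bigr => J _; rewrite rmorph_prod.
by apply: eq_bigr => j _; rewrite (nth_map 0) ?size_tuple.
Qed.

(** The determinant involves [a] and [b] only through their squares, so any square roots of [lB s g]
    and [mB s g] serve. *)
Lemma realized_by_flip (F : numFieldType) (s : 5.-tuple F) (g a b : F) :
  root (Qpoly s) g -> a ^+ 2 = lB s g -> b ^+ 2 = mB s g ->
  realized_by s
    (\matrix_(i < 5, j < 5)
      nth 0 (nth [::]
        [:: [:: g; a; b; 0; 0];
            [:: a; 0; 0; 0; kB s g];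
            [:: b; 0; elsym 1 s - 2 * g; b; 0];
            [:: 0; 0; b; g; a];
            [:: 0; kB s g; 0; a; 0]] i) j).
Proof.
move=> root_g sqr_a sqr_b; rewrite /realized_by /char_poly.
rewrite (_ : char_poly_mx _ = \matrix_(i < 5, j < 5)
    nth 0 (nth [::]
      [:: [:: 'X - g%:P; - a%:P; - b%:P; 0; 0];
          [:: - a%:P; 'X; 0; 0; - (kB s g)%:P];
          [:: - b%:P; 0; 'X - (elsym 1 s - 2 * g)%:P; - b%:P; 0];
          [:: 0; 0; - b%:P; 'X - g%:P; - a%:P];
          [:: 0; - (kB s g)%:P; 0; - a%:P; 'X]] i) j); last first.
  apply/matrixP => i j; rewrite !mxE.
  by case: i j => [[|[|[|[|[|]]]]] ?] // [[|[|[|[|[|]]]]] ?] //=;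
     rewrite ?mulr0n ?mulr1n ?sub0r ?subr0 ?polyC0 ?oppr0 ?subr0.
rewrite det_flip !sqrrN -!polyC_exp sqr_a sqr_b.
have -> : \prod_(x <- s) ('X - x%:P) = ('X - (s`_0)%:P) * ('X - (s`_1)%:P)
    * ('X - (s`_2)%:P) * ('X - (s`_3)%:P) * ('X - (s`_4)%:P).
  by rewrite (big_nth 0) size_tuple big_mkord !big_ord_recr big_ord0 /= mul1r.
have [e1E e2E e3E] := elsym123E _ s.
have {root_g} : (Qpoly s).[g] = 0 by apply/rootP.
rewrite /Qpoly !(hornerD, hornerN, hornerM, hornerC, hornerXn, hornerX) /kB /lB /mB e1E e2E e3E.
move: s`_0 s`_1 s`_2 s`_3 s`_4 => x1 x2 x3 x4 x5 Qg.
(* Here [M] is [mB s g]; doubling it clears the denominator, so that [ring] can settle the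
   polynomial identity. *)
set M := (X in _ * (_ - 2 * X%:P * _)).
have M2 : 2 * M = 2 * (x1 + x2 + x3 + x4 + x5) * g - 2 * g ^+ 2
    - (x1 * x2 + (x1 + x2) * x3 + (x1 + x2 + x3) * x4
       + (x1 + x2 + x3 + x4) * x5 + x3 ^+ 2 + x5 ^+ 2) by rewrite /M; field.
have -> : 2 * M%:P = (2 * M)%:P by rewrite polyCM polyC_natr.
rewrite {}M2 {M}.
(* The two sides differ by the constant Q(g) in the 3x3 factor. *)
have /(congr1 (fun c => ('X - x3%:P) * ('X - x5%:P) * c%:P)) := Qg.
rewrite polyC0 mulr0 -[RHS in _ -> _ = RHS]addr0 => <-.
ring.
Qed.

Theorem lemma7 (R : realType) (s : 5.-tuple R)
    (h_i : 0 <= elsym 1 s)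
    (h_ii : elsym 1 s < s`_2)
    (h_iii : [/\ s`_0 >= s`_1, s`_1 >= s`_2, s`_2 >= s`_3, s`_3 >= s`_4
               & s`_4 >= - s`_0])
    (g : R) (h_root : root (Qpoly s) g)
    (h_g0 : 0 <= g) (h_g1 : g <= 2^-1 * elsym 1 s) :
  nonneg_mx (Bmx (map_tuple (real_complex R) s) g%:C) /\
  (exists A : 'M[R]_5,
    [/\ nonneg_mx A, A^T = A & realized_by s A]).
Proof.
have [k_ge0 l_ge0 m_ge0 c_ge0] : [/\ 0 <= kB s g, 0 <= lB s g, 0 <= mB s g
    & 0 <= elsym 1 s - 2 * g].
  have [e1E e2E _] := elsym123E _ s; case: h_iii => [h01 h12 h23 h34 h40].
  rewrite /kB /lB /mB; split; last by lra.
  (* From e_1 < lambda_3 and lambda_1 + lambda_4 >= 0 follows lambda_2 + lambda_5 < 0, hence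
     lambda_3 + lambda_5 < 0. *)
  - lra.
  (* Both factors are nonpositive: g <= e_1 < lambda_3, and lambda_5 < - lambda_2 < 0 <= g. *)
  - by apply: mulr_le0; lra.
  (* These four products are the summands of 4 m; once e_1 and e_2 are expanded, the identity is
     linear in the monomials. *)
  - have h1 : 0 <= g * (elsym 1 s - g) by apply: mulr_ge0; lra.
    have h2 : 0 <= (s`_1 - s`_2) * (s`_1 + s`_2) by apply: mulr_ge0; lra.
    have h3 : 0 <= (s`_0 - s`_4) * (s`_0 + s`_4) by apply: mulr_ge0; lra.
    have h4 : 0 <= (- s`_3 - elsym 1 s) * (- s`_3 + elsym 1 s).
      by apply: mulr_ge0; lra.
    rewrite e1E in h1 h4 *; rewrite e2E; lra.
(* Since l and m are nonnegative, their principal complex roots are real, so B is the image of this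
   real matrix. *)
pose A : 'M[R]_5 := \matrix_(i < 5, j < 5)
  nth 0 (nth [::]
    [:: [:: g; Num.sqrt (lB s g); Num.sqrt (mB s g); 0; 0];
        [:: Num.sqrt (lB s g); 0; 0; 0; kB s g];
        [:: Num.sqrt (mB s g); 0; elsym 1 s - 2 * g; Num.sqrt (mB s g); 0];
        [:: 0; 0; Num.sqrt (mB s g); g; Num.sqrt (lB s g)];
        [:: 0; kB s g; 0; Num.sqrt (lB s g); 0]] i) j.
have A_ge0 : nonneg_mx A.
  move=> i j; rewrite !mxE.
  by case: i j => [[|[|[|[|[|]]]]] ?] // [[|[|[|[|[|]]]]] ?] //=;
     exact: sqrtr_ge0.
have A_real : Bmx (map_tuple (real_complex R) s) g%:C = map_mx (real_complex R) A.
  have nthC j : (j < 5)%N -> (map_tuple (real_complex R) s)`_j = (s`_j)%:C.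
    by move=> j5; rewrite (nth_map 0) ?size_tuple.
  have sqrtC x : 0 <= x -> sqrtc x%:C = (Num.sqrt x)%:C.
    by move=> x0; rewrite sqrtc_sqrtr // ler0c.
  have kE : kB (map_tuple (real_complex R) s) g%:C = (kB s g)%:C.
    by rewrite /kB !nthC // !rmorphB.
  have lE : lB (map_tuple (real_complex R) s) g%:C = (lB s g)%:C.
    by rewrite /lB !nthC // rmorphM !rmorphB.
  have mE : mB (map_tuple (real_complex R) s) g%:C = (mB s g)%:C.
    rewrite /mB !nthC // !elsym_map.
    by rewrite !(rmorphB, rmorphD, rmorphM, rmorphN, rmorphXn, fmorphV, rmorph_nat).
  apply/matrixP => i j; rewrite !mxE kE lE mE !sqrtC // !elsym_map.
  by case: i j => [[|[|[|[|[|]]]]] ?] // [[|[|[|[|[|]]]]] ?] //=;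
     rewrite !(rmorphB, rmorphM, rmorph_nat, rmorph0).
split; first by move=> i j; rewrite A_real mxE ler0c A_ge0.
exists A; split=> //.
  apply/matrixP => i j; rewrite !mxE.
  by case: i j => [[|[|[|[|[|]]]]] ?] // [[|[|[|[|[|]]]]] ?].
by apply: realized_by_flip; rewrite ?sqr_sqrtr.
Qed.
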